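(* Assume the map $\theta$ is invertible, and put $\psi_t(y) := \int_X g\circ\varphi_t \, dP_{\theta^{-1}(y)}$ for $t\in T$, $y\in(y_{\min},y_{\max})$, where $T=-T$. Suppose each $\varphi_t$ is invertible with $\varphi_t^{-1}=\varphi_{-t}$, and that there is a measurable involution $R:X\to X$ (i.e. $R=R^{-1}$) such that $\varphi_t\circ R=R\circ\varphi_{-t}$ for all $t\in T$. If $g\circ R=g$ and $\mu\circ R^{-1}=\mu$, then $\psi_t(y)=\psi_{-t}(y)$ for all $t\in T$ and all $y\in(y_{\min},y_{\max})$.
   Context: Setting. $(X,d)$ is a complete separable metric space with its Borel $\sigma$-algebra and $\mu$ is a Borel probability measure on $X$. $g: X\to\mathbb{R}$ is measurable, bounded, and continuous $\mu$-almost everywhere (i.e. its set of discontinuity points is $\mu$-null). $y_{\min}=\inf g(X)$, $y_{\max}=\sup g(X)$, $Y=[y_{\min},y_{\max}]$. $T\subseteq\mathbb{R}$ is a set of times with $0\in T$; for each $t\in T$, $\varphi_t:X\to X$ is measurable and continuous $\mu$-a.e., with $\varphi_0=\mathrm{id}$. Canonical measures. For $\lambda\in\mathbb{R}$, $Z(\lambda)=\int_X e^{\lambda g}\,d\mu$ and $P_\lambda$ is the probability measure with $dP_\lambda = \frac{e^{\lambda g}}{Z(\lambda)}\,d\mu$. The map $\theta:[-\infty,+\infty]\to Y$ is given by $\theta(\lambda)=\int_X g\,dP_\lambda$ for $\lambda\in\mathbb{R}$, $\theta(-\infty)=y_{\min}$, $\theta(+\infty)=y_{\max}$. *)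

(* Defs.v *)
From HB Require Import structures.
From mathcomp Require Import all_boot all_order all_algebra.
From mathcomp Require Import all_classical all_reals all_analysis.
From mathcomp Require Import measurable_realfun.

Set Implicit Arguments.
Unset Strict Implicit.
Unset Printing Implicit Defensive.

Import Order.TTheory GRing.Theory Num.Theory.
Import numFieldNormedType.Exports.

Local Open Scope classical_set_scope.
Local Open Scope ring_scope.

(* The measurable structure is unrelated to the topology here; that it is the
   Borel one is the separate predicate [borel_measurable]. The base point
   carried by [Complete] and [Measurable] only says that the space is
   nonempty. *)
#[short(type="measurableCompleteMetricType")]
HB.structure Definition MeasurableCompleteMetric (d : measure_display)
  (R : numDomainType) := { X of Metric R X & Complete X & Measurable d X }.

Definition separable (X : topologicalType) : Prop :=
  exists2 D : set X, countable D & dense D.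

Definition borel_measurable (d : measure_display) (R : numDomainType)
    (X : measurableCompleteMetricType d R) : Prop :=
  @measurable d X = <<s [set U : set X | open U] >>.

Definition ae_continuous (d : measure_display) (R : realType)
    (X : measurableCompleteMetricType d R) (mu : {measure set X -> \bar R})
    (Y : topologicalType) (f : X -> Y) : Prop :=
  mu.-negligible [set x | ~ {for x, continuous f}].

Section canonical_measures.
Context (d : measure_display) (X : measurableType d) (R : realType).
Variables (mu : probability X R) (g : {mfun X >-> R}).

Definition partition_function (lambda : R) : R :=
  \int[mu]_x expR (lambda * g x).

Definition canonical_measure (lambda : R) (A : set X) : \bar R :=
  (\int[mu]_(x in A) (expR (lambda * g x) / partition_function lambda)%:E)%E.

Section measure_structure.
Variable lambda : R.
Local Notation P := (canonical_measure lambda).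
Let dens (x : X) : \bar R :=
  (expR (lambda * g x) / partition_function lambda)%:E.

Let measurable_dens : measurable_fun setT dens.
Proof.
apply/measurable_EFinP; apply: measurable_funM => //.
apply: measurableT_comp => //; exact: measurable_funM.
Qed.

Let dens_ge0 x : (0 <= dens x)%E.
Proof.
rewrite lee_fin divr_ge0 ?expR_ge0// /partition_function /Rintegral.
apply: fine_ge0; apply: integral_ge0 => z _; by rewrite lee_fin expR_ge0.
Qed.

Let P0 : P set0 = 0%E.
Proof. exact: integral_set0. Qed.

Let P_ge0 A : (0 <= P A)%E.
Proof. by apply: integral_ge0 => x _; exact: dens_ge0. Qed.

Let P_sigma_additive : semi_sigma_additive P.
Proof.
move=> F mF tF mUF; rewrite /canonical_measure ge0_integral_bigcup//.
- apply: is_cvg_ereal_nneg_natsum_cond => n _ _.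
  by apply: integral_ge0 => x _; exact: dens_ge0.
- exact: measurable_funTS.
- by move=> x _; exact: dens_ge0.
Qed.

HB.instance Definition _ := isMeasure.Build _ _ _ P P0 P_ge0 P_sigma_additive.

End measure_structure.

Section bounded.
Hypothesis g_bounded : bounded_fun g.
Variable lambda : R.

Let expR_bounded : exists M : R, forall x,
  expR (- M) <= expR (lambda * g x) <= expR M.
Proof.
have [M [_ gM]] := g_bounded.
exists (`|lambda| * (M + 1)) => x.
have gM1 : `|lambda * g x| <= `|lambda| * (M + 1).
  by rewrite normrM ler_wpM2l//; apply: (gM (M + 1)) => //; rewrite ltrDl.
by rewrite !ler_expR -ler_norml.
Qed.

Let measurable_expRg :
  measurable_fun setT (fun x : X => (expR (lambda * g x))%:E : \bar R).
Proof.
apply/measurable_EFinP; apply: measurableT_comp => //.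
exact: measurable_funM.
Qed.

Let integrable_expRg :
  mu.-integrable setT (fun x => (expR (lambda * g x))%:E).
Proof.
have [M gM] := expR_bounded.
apply: (@le_integrable _ _ _ mu setT measurableT _ (cst (expR M)%:E)) => //.
- move=> x _ /=; rewrite lee_fin !ger0_norm ?expR_ge0//.
  by have /andP[] := gM x.
- exact: finite_measure_integrable_cst.
Qed.

Let partition_functionE :
  (partition_function lambda)%:E = (\int[mu]_x (expR (lambda * g x))%:E)%E.
Proof.
rewrite /partition_function /Rintegral fineK//.
exact: integrable_fin_num integrable_expRg.
Qed.

Lemma partition_function_gt0 : 0 < partition_function lambda.
Proof.
have [M gM] := expR_bounded.
rewrite -lte_fin partition_functionE.
apply: (@lt_le_trans _ _ (\int[mu]_(x in setT) (cst (expR (- M))%:E x))%E).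
  by rewrite integral_cst//= probability_setT mule1 lte_fin expR_gt0.
apply: ge0_le_integral => //.
- by move=> x _; rewrite lee_fin expR_ge0.
- by move=> x _; rewrite lee_fin; have /andP[] := gM x.
Qed.

Lemma canonical_measure_setT : canonical_measure lambda setT = 1%E.
Proof.
rewrite /canonical_measure.
under eq_integral do rewrite mulrC EFinM.
rewrite integralZl//= -partition_functionE -EFinM mulVf//.
by rewrite gt_eqF// partition_function_gt0.
Qed.

End bounded.

Definition ymin : R := inf (range g).
Definition ymax : R := sup (range g).

Definition theta (l : \bar R) : R :=
  match l with
  | lambda%:E => \int[canonical_measure lambda]_x g x
  | -oo%E => ymin
  | +oo%E => ymax
  end.

Definition theta_invertible : Prop := set_bij [set: \bar R] `[ymin, ymax] theta.

Definition theta_inv : R -> \bar R := 'pinv_(cst 0%E) [set: \bar R] theta.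

(* For y in ]ymin, ymax[ the point theta_inv y is finite, theta sending
   -oo and +oo to ymin and ymax; hence [fine]. *)
Definition psi (phi : R -> X -> X) (t y : R) : R :=
  \int[canonical_measure (fine (theta_inv y))]_x g (phi t x).

End canonical_measures.

(* Main.v *)
Require Import Defs.
From HB Require Import structures.
From mathcomp Require Import all_boot all_order all_algebra.
From mathcomp Require Import all_classical all_reals all_analysis.
From mathcomp Require Import measurable_realfun.

Set Implicit Arguments.
Unset Strict Implicit.
Unset Printing Implicit Defensive.

Import Order.TTheory GRing.Theory Num.Theory.
Import numFieldNormedType.Exports.

Local Open Scope classical_set_scope.
Local Open Scope ring_scope.

(** The density of the canonical measure $P_\lambda$ is a function of $g$ alone, so a map $r$
    preserving both $\mu$ and $g$ preserves $P_\lambda$ ([canonical_measure_invariant]).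
    Substituting $r x$ for $x$ ([integral_invariant]) then gives $\int g\circ\varphi_t\,dP_\lambda =
    \int g\circ\varphi_t\circ r\,dP_\lambda = \int g\circ r\circ\varphi_{-t}\,dP_\lambda = \int
    g\circ\varphi_{-t}\,dP_\lambda$. The value $y$ enters only through $\lambda$, which is the same
    at times $t$ and $-t$. *)

Section invariant_integral.
Context (d : measure_display) (X : measurableType d) (R : realType).
Variables (mu : {measure set X -> \bar R}) (r : X -> X).
Hypotheses (r_meas : measurable_fun [set: X] r)
  (r_mu : forall A : set X, measurable A -> pushforward mu r A = mu A).
Local Open Scope ereal_scope.

(** Change of variables along $r$, whose image measure is $\mu$ itself. A general domain [D] is
    allowed because the canonical measure of a set is an integral over that set. *)
Lemma ge0_integral_invariant (D : set X) (f : X -> \bar R) :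
  measurable D -> measurable_fun [set: X] f -> (forall x, 0 <= f x) ->
  \int[mu]_(x in r @^-1` D) f (r x) = \int[mu]_(x in D) f x.
Proof.
move=> mD mf f0.
rewrite -(@ge0_integral_pushforward _ _ _ _ _ r r_meas mu D f)//; last first.
  exact: measurable_funTS.
by apply: eq_measure_integral => A mA _; exact: r_mu.
Qed.

(** Taking positive and negative parts commutes with composition by [r], so the nonnegative case
    applies to each part. *)
Lemma integral_invariant (f : X -> \bar R) : measurable_fun [set: X] f ->
  \int[mu]_x f (r x) = \int[mu]_x f x.
Proof.
move=> mf; rewrite integralE [RHS]integralE.
rewrite -(@ge0_integral_invariant setT f^\+)//; last exact: measurable_funepos.
rewrite -(@ge0_integral_invariant setT f^\-)//; last exact: measurable_funeneg.
by rewrite preimage_setT; congr (_ - _); apply: eq_integral => x _;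
  rewrite !(funeposE, funenegE).
Qed.

End invariant_integral.

Lemma canonical_measure_invariant (d : measure_display) (X : measurableType d)
    (R : realType) (mu : probability X R) (g : {mfun X >-> R}) (lambda : R)
    (r : X -> X) :
  measurable_fun [set: X] r -> g \o r = g ->
  (forall A : set X, measurable A -> pushforward mu r A = mu A) ->
  forall A : set X, measurable A ->
    pushforward (canonical_measure mu g lambda) r A
    = canonical_measure mu g lambda A.
Proof.
move=> r_meas r_g r_mu A mA; rewrite /pushforward /canonical_measure.
rewrite -[RHS](ge0_integral_invariant r_meas r_mu)//.
(* Only the numerator of the density depends on the point, and there $g x = g (r x)$. *)
- by apply: eq_integral => x _; rewrite -[in LHS]r_g.
- apply/measurable_EFinP; apply: measurable_funM => //.
  by apply: measurableT_comp => //; exact: measurable_funM.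
- move=> x; rewrite lee_fin divr_ge0 ?expR_ge0//.
  by apply: Rintegral_ge0 => z _; exact: expR_ge0.
Qed.

Theorem mainTheorem5 (R : realType) (d : measure_display)
  (X : measurableCompleteMetricType d R)
  (X_separable : separable X)
  (X_borel : borel_measurable X)
  (mu : probability X R)
  (g : {mfun X >-> R})
  (g_bounded : bounded_fun g)
  (g_cont : ae_continuous mu g)
  (T : set R)
  (T0 : T 0)
  (T_sym : [set - t | t in T] = T)
  (phi : R -> X -> X)
  (phi_meas : forall t, T t -> measurable_fun [set: X] (phi t))
  (phi_cont : forall t, T t -> ae_continuous mu (phi t))
  (phi0 : phi 0 = id)
  (theta_bij : theta_invertible mu g)
  (phi_inv : forall t, T t ->
     cancel (phi t) (phi (- t)) /\ cancel (phi (- t)) (phi t))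
  (r : X -> X)
  (r_meas : measurable_fun [set: X] r)
  (r_invol : involutive r)
  (r_phi : forall t, T t -> phi t \o r = r \o phi (- t))
  (r_g : g \o r = g)
  (r_mu : forall A : set X, measurable A -> pushforward mu r A = mu A) :
  forall t : R, T t -> forall y : R, y \in `]ymin g, ymax g[ ->
    psi mu g phi t y = psi mu g phi (- t) y.
Proof.
move=> t Tt y _; rewrite /psi /Rintegral; congr fine.
set lambda := fine _.
have mgphi : measurable_fun [set: X] (fun x => (g (phi t x))%:E).
  by apply/measurable_EFinP; apply: measurableT_comp => //; exact: phi_meas.
(* Only the integral at time $t$ is transformed. *)
rewrite -(integral_invariant r_meas
  (canonical_measure_invariant lambda r_meas r_g r_mu) mgphi).
apply: eq_integral => x _; congr EFin.
(* Reversibility moves [r] outside the flow, where $g\circ r = g$ absorbs it. *)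
by rewrite -[phi t (r x)]/((phi t \o r) x) r_phi// -[in RHS]r_g.
Qed.
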